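(* For all integers $m,n$ with $1\le m\le n$, $R(c(nK_3),mK_2)=3n+m-1$.
   Context: $mK_2$ denotes a matching of $m$ pairwise vertex-disjoint edges. $c(nK_3)$ (a connected triangle matching) denotes any connected graph containing $n$ pairwise vertex-disjoint triangles. $R(c(nK_3),mK_2)$ denotes the smallest positive integer $N$ such that in every coloring of the edges of the complete graph $K_N$ with two colors (red and blue), either the graph of red edges contains as a subgraph some connected graph containing $n$ pairwise vertex-disjoint triangles (equivalently, some connected component of the red graph contains $n$ pairwise vertex-disjoint triangles), or the graph of blue edges contains $m$ pairwise vertex-disjoint edges. *)

(* Defs.v *)
From mathcomp Require Import all_boot.

Set Implicit Arguments.
Unset Strict Implicit.
Unset Printing Implicit Defensive.

(* Finite simple graphs. *)
Record sgraph := SGraph {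
  vertex :> finType;
  adj : rel vertex;
  adj_sym : symmetric adj;
  adj_irr : irreflexive adj }.

(* Subgraphs are not required to be induced. *)
Definition contains (G H : sgraph) : Prop :=
  exists f : H -> G,
    injective f /\ forall x y : H, adj x y -> adj (f x) (f y).

Definition connected (G : sgraph) : Prop :=
  forall x y : G, connect (@adj G) x y.

(* k K_t: the vertex (i, j) is the j-th vertex of the i-th copy of K_t. *)
Section Copies.
Variables k t : nat.

Definition copies_adj : rel ('I_k * 'I_t) :=
  fun p q => (p.1 == q.1) && (p.2 != q.2).

Lemma copies_sym : symmetric copies_adj.
Proof. by move=> p q; rewrite /copies_adj eq_sym (eq_sym p.2). Qed.

Lemma copies_irr : irreflexive copies_adj.
Proof. by move=> p; rewrite /copies_adj !eqxx. Qed.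

Definition copies : sgraph := SGraph copies_sym copies_irr.

End Copies.

(* The family c(n K_3). *)
Definition connected_triangle_matching (n : nat) (H : sgraph) : Prop :=
  connected H /\ contains H (copies n 3).

Inductive color := Red | Blue.

Definition is_color (a b : color) : bool :=
  match a, b with Red, Red | Blue, Blue => true | _, _ => false end.

(* Edges of K_N are the two-element sets of vertices; the values of a coloring
   on other sets are never used. *)
Definition coloring (N : nat) := {set 'I_N} -> color.

Section ColorClass.
Variables (N : nat) (c : coloring N) (a : color).

Definition color_adj : rel 'I_N :=
  fun x y => (x != y) && is_color (c [set x; y]) a.

Lemma color_sym : symmetric color_adj.
Proof. by move=> x y; rewrite /color_adj eq_sym setUC. Qed.

Lemma color_irr : irreflexive color_adj.
Proof. by move=> x; rewrite /color_adj eqxx. Qed.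

Definition color_graph : sgraph := SGraph color_sym color_irr.

End ColorClass.

Definition arrows (N : nat) (F : sgraph -> Prop) (G : sgraph) : Prop :=
  forall c : coloring N,
    (exists H : sgraph, F H /\ contains (color_graph c Red) H)
    \/ contains (color_graph c Blue) G.

(* R(F, G) = N. *)
Definition is_ramsey_number (F : sgraph -> Prop) (G : sgraph) (N : nat) : Prop :=
  [/\ 0 < N, arrows N F G
    & forall N' : nat, 0 < N' -> arrows N' F G -> N <= N'].

(* Main.v *)
Require Import Defs.
From mathcomp Require Import all_boot zify.

Set Implicit Arguments.
Unset Strict Implicit.
Unset Printing Implicit Defensive.

(** Upper bound: let a blue matching of k < m edges admit no augmentation by a
    blue path of length 1 or 3. The set U of uncovered vertices is then a red
    clique, and every matching edge has an endpoint y with at most one blue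
    neighbour in U. Greedily complete each of these k vertices y to a red
    triangle by two vertices of U, and cut the rest of U into triangles; since
    |U| + k = 3n + m - 1 - k >= 3n, at least n triangles result, and they all
    meet the clique U, so their union is connected. *)

(** * Packings of vertex-disjoint cliques *)

(** Packings are lists of vertex lists, so that exchanging cliques is a list operation;
    [uniq (flatten ss)] covers both disjointness and distinctness inside each clique. *)
Definition clique_packing (G : sgraph) (t : nat) (ss : seq (seq G)) : bool :=
  [&& uniq (flatten ss), all (fun s => size s == t) ss
    & all (pairwise (@adj G)) ss].

Lemma pairwise_nth (G : sgraph) (x0 : G) (s : seq G) (i j : nat) :
  pairwise (@adj G) s -> i < size s -> j < size s -> i != j ->
  adj (nth x0 s i) (nth x0 s j).
Proof.
move=> /(pairwiseP x0) s_adj i_s j_s; rewrite neq_ltn => /orP[ij | ji].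
  exact: s_adj.
by rewrite adj_sym; apply: s_adj.
Qed.

(** Injectivity: (i, j) is recovered from its index in the duplicate-free list [flatten ss]. The map
    [f] is explicit since connectivity arguments need to know which clique a vertex lies in. *)
Lemma clique_packing_embedding (G : sgraph) (x0 : G) (k t : nat)
    (ss : seq (seq G)) :
  clique_packing t ss -> size ss = k ->
  let f (p : copies k t) := nth x0 (nth [::] ss p.1) p.2 in
  injective f /\ forall p q : copies k t, adj p q -> adj (f p) (f q).
Proof.
move=> /and3P[ss_uniq /allP ss_t /allP ss_adj] <- f.
have nth_ss (i : 'I_(size ss)) : nth [::] ss i \in ss by exact: mem_nth.
have sz (i : 'I_(size ss)) : size (nth [::] ss i) = t by apply/eqP/ss_t.
split=> [[i j] [i' j'] | [i j] [i' j']].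
  have off (l : 'I_(size ss)) (u : 'I_t) : u < nth 0 (shape ss) l.
    by rewrite (nth_map [::]) // sz.
  have fE (l : 'I_(size ss)) (u : 'I_t) :
      f (l, u) = nth x0 (flatten ss) (flatten_index (shape ss) l u).
    by rewrite nth_flatten flatten_indexKl ?flatten_indexKr.
  have bound (l : 'I_(size ss)) (u : 'I_t) :
      flatten_index (shape ss) l u < size (flatten ss).
    by rewrite size_flatten flatten_indexP.
  rewrite !fE => /eqP; rewrite nth_uniq // => /eqP eq_ij.
  congr pair; apply: val_inj => /=.
    by rewrite -(flatten_indexKl (off i j)) eq_ij flatten_indexKl.
  by rewrite -(flatten_indexKr (off i j)) eq_ij flatten_indexKr.
rewrite /= /copies_adj /= => /andP[/eqP <- neq_j].
by apply: pairwise_nth; rewrite ?sz ?ss_adj.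
Qed.

Lemma contains_copies (G : sgraph) (x0 : G) (k t : nat) (ss : seq (seq G)) :
  clique_packing t ss -> size ss = k -> contains G (copies k t).
Proof.
by move=> ssP sz; eexists; apply: (clique_packing_embedding x0 ssP sz).
Qed.

(** * Connected unions of triangles meeting a clique *)

Section Pullback.
Variables (G : sgraph) (V : finType) (f : V -> G).

Definition pullback_adj : rel V := fun x y => adj (f x) (f y).

Lemma pullback_sym : symmetric pullback_adj.
Proof. by move=> x y; apply: adj_sym. Qed.

Lemma pullback_irr : irreflexive pullback_adj.
Proof. by move=> x; apply: adj_irr. Qed.

Definition pullback : sgraph := SGraph pullback_sym pullback_irr.

End Pullback.

Definition clique (G : sgraph) (U : {set G}) : Prop :=
  {in U &, forall x y, x != y -> adj x y}.

(** Within its triangle every vertex reaches a vertex of [U], and two vertices of [U] are equal or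
    adjacent. The witness is the pullback of [G] to the triangle vertices: it keeps the edges of [U]
    between different triangles. *)
Lemma contains_connected_triangles (G : sgraph) (x0 : G) (n : nat)
    (U : {set G}) (ts : seq (seq G)) :
  clique U -> clique_packing 3 ts -> size ts = n -> all (has (mem U)) ts ->
  exists H : sgraph, connected_triangle_matching n H /\ contains G H.
Proof.
move=> U_clique tsP szn ts_U.
have [] := clique_packing_embedding x0 tsP szn.
set f := (fun p : copies n 3 => _) => f_inj f_adj.
exists (pullback f); split; last by exists f.
split; last by exists id; split.
have to_U (p : pullback f) :
    exists2 q : pullback f, f q \in U & connect (@adj (pullback f)) p q.
  case: p => i j; set t := nth [::] ts i.
  have t_ts : t \in ts by rewrite mem_nth ?szn.
  have sz_t : size t = 3 by case/and3P: tsP => _ /allP/(_ _ t_ts)/eqP.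
  have /(allP ts_U) t_U := t_ts.
  have l_lt : find (mem U) t < 3 by rewrite -sz_t -has_find.
  exists (i, Ordinal l_lt); first exact: (nth_find x0 t_U).
  have [<- | neq_j] := eqVneq j (Ordinal l_lt); first exact: connect0.
  by apply/connect1/f_adj; rewrite /= /copies_adj eqxx.
move=> p q; have [p' p'U pp'] := to_U p; have [q' q'U qq'] := to_U q.
apply: connect_trans pp' _.
rewrite (sym_connect_sym (@adj_sym _)) in qq'.
apply: connect_trans qq'.
have [<- | neq] := eqVneq p' q'; first exact: connect0.
by apply/connect1/U_clique => //; rewrite (inj_eq f_inj).
Qed.

(** * Matchings and short augmenting paths *)

Lemma transversal_has (T : eqType) (P : pred T) (ss : seq (seq T)) :
  all (has P) ss ->
  exists ys, [/\ size ys = size ss, subseq ys (flatten ss) & all P ys].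
Proof.
elim: ss => [|s ss IH] /=; first by exists [::].
case/andP=> /hasP[y y_s Py] /IH[ys [sz sub allP]].
exists (y :: ys); split; rewrite /= ?sz ?Py //.
by rewrite -cat1s cat_subseq // sub1seq.
Qed.

Lemma matching_augment (G : sgraph) (ss : seq (seq G)) :
  clique_packing 2 ss ->
  let U := [set x | x \notin flatten ss] in
  (exists2 ss' : seq (seq G), clique_packing 2 ss' & size ss' = (size ss).+1) \/
  {in U &, forall x y, ~~ adj x y} /\
  all (has (fun x => #|[set u in U | adj x u]| <= 1)) ss.
Proof.
move=> ssP U; have /and3P[ss_uniq ss_2 ss_adj] := ssP.
case: (boolP [exists x in U, exists y in U, adj x y]) => [|no_edge].
  case/exists_inP=> x xU /exists_inP[y yU xy]; left.
  exists ([:: x; y] :: ss) => //.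
  have neq_xy : x != y by apply: contraTneq xy => ->; rewrite adj_irr.
  rewrite !inE in xU yU.
  by rewrite /clique_packing /= inE negb_or neq_xy xU yU ss_uniq ss_2 xy ss_adj.
case: (boolP (all _ ss)) => [ss_has | /allPn[s s_ss s_no]]; [right | left].
  split=> // x y xU yU; apply: contra no_edge => xy.
  by apply/exists_inP; exists x => //; apply/exists_inP; exists y.
have s_2 := allP ss_2 _ s_ss.
case: s s_2 s_ss s_no => [|x [|y []]] //= _ s_ss.
(* Both ends of the matching edge xy have two neighbours in [U], so y has a neighbour v distinct
   from the neighbour u chosen for x. Along the path u x y v, the edge xy is exchanged for xu and
   yv. *)
rewrite orbF negb_or -!ltnNge => /andP[x_gt y_gt].
have [u] : exists u, u \in [set u in U | adj x u].
  by apply/card_gt0P/ltnW.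
rewrite inE => /andP[uU xu].
have [v] : exists v, v \in [set v in U | adj y v] :\ u.
  by apply/card_gt0P; rewrite (cardsD1 u) in y_gt; lia.
rewrite !inE => /and3P[neq_vu vU yv].
rewrite inE in uU.
have ss_perm := perm_to_rem s_ss; set ss' := rem _ ss in ss_perm.
exists [:: [:: x; u], [:: y; v] & ss']; last by rewrite (perm_size ss_perm).
have fl_perm := perm_flatten ss_perm.
rewrite (perm_uniq fl_perm) in ss_uniq.
rewrite !(perm_mem fl_perm) in uU vU.
move: ss_2 ss_adj; rewrite !(perm_all _ ss_perm).
move: ss_uniq uU vU; rewrite /clique_packing /= !inE !negb_or.
case/and3P=> /andP[xy xss] yss -> /and3P[ux uy uss] /and3P[vx vy vss] -> /andP[_ ->].
by rewrite xu yv xy xss yss uss vss (eq_sym x u) ux (eq_sym x v) vx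
  (eq_sym u y) eq_sym uy (eq_sym u v) neq_vu (eq_sym y v) vy.
Qed.

Lemma unaugmentable_matching (G : sgraph) (m : nat) :
  (exists2 ss : seq (seq G), clique_packing 2 ss & size ss = m) \/
  exists ss : seq (seq G),
    let U := [set x | x \notin flatten ss] in
    [/\ clique_packing 2 ss, size ss < m, {in U &, forall x y, ~~ adj x y}
      & all (has (fun x => #|[set u in U | adj x u]| <= 1)) ss].
Proof.
elim: m => [|m [[ss ssP sz] | [ss [ssP sz U_stable ss_has]]]].
- by left; exists [::].
- have [[ss' ss'P sz'] | [U_stable ss_has]] := matching_augment ssP.
    by left; exists ss'; rewrite // sz' sz.
  by right; exists ss; rewrite sz.
- by right; exists ss; split=> //; apply: ltnW.
Qed.

(** * Greedy construction of triangles *)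

(** Each round builds one triangle, from a vertex of [ys] while any is left and from [U] alone
    afterwards, so |U| + |ys| drops by three. The last conclusion keeps later triangles disjoint
    from the current one. *)
Lemma greedy_triangles (G : sgraph) (n : nat) (U : {set G}) (ys : seq G) :
  clique U -> uniq ys -> {in ys, forall y, y \notin U} ->
  {in ys, forall y, #|[set u in U | ~~ adj y u]| <= 1} ->
  size ys <= n.-1 -> 3 * n <= #|U| + size ys ->
  exists ts : seq (seq G),
    [/\ clique_packing 3 ts, size ts = n, all (has (mem U)) ts
      & {subset flatten ts <= [predU mem ys & mem U]}].
Proof.
elim: n U ys => [|n IH] U ys U_clique ys_uniq ysU ys_few sz_ys sz_U.
  by exists [::].
(* [U1] and [ys1] are what is left once the apex [a] is removed; the 2 in [3 * n + 2] pays for its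
   two neighbours [b] and [c], taken from [U1] next. *)
have [a [U1 [ys1
    [[aUys aU1 a_ys1 sU1] [sub_ys uniq_ys1 sz_ys1] sz_U1 a_gt1]]]] :
    exists a (U1 : {set G}) (ys1 : seq G),
    [/\ [/\ (a \in ys) || (a \in U), a \notin U1, a \notin ys1
          & U1 \subset U],
      [/\ {subset ys1 <= ys}, uniq ys1 & size ys1 <= n.-1],
      3 * n + 2 <= #|U1| + size ys1 & 1 < #|[set u in U1 | adj a u]|].
  case: ys => [|y ys] /= in ys_uniq ysU ys_few sz_ys sz_U *.
    have [a aU] : exists a, a \in U by apply/card_gt0P; lia.
    have sz_Ua := cardsD1 a U; rewrite aU in sz_Ua.
    exists a, (U :\ a), [::]; split=> //=.
    - by rewrite aU !inE eqxx subD1set.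
    - by lia.
    rewrite (_ : [set u in _ | _] = U :\ a); first by lia.
    apply/setP=> u; rewrite !inE; apply: andb_idr => /andP[neq_ua uU].
    by rewrite U_clique // eq_sym.
  case/andP: ys_uniq => y_ys ys_uniq.
  exists y, U, ys; split=> //.
  - by rewrite mem_head ysU ?mem_head.
  - by split=> // [x x_ys|]; [rewrite inE x_ys orbT | lia].
  - by lia.
  (* At most n vertices were in the list, so |U| is at least 2n + 3; as y misses at most one of
     them, two neighbours remain. *)
  have := ys_few y (mem_head _ _).
  have := cardsID [set u | adj y u] U.
  rewrite (_ : U :\: _ = [set u in U | ~~ adj y u]); last first.
    by apply/setP=> u; rewrite !inE andbC.
  rewrite (_ : U :&: _ = [set u in U | adj y u]); last first.
    by apply/setP=> u; rewrite !inE.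
  by lia.
have /card_gt1P[b [c []]] := a_gt1.
rewrite !inE => /andP[bU1 ab] /andP[cU1 ac] neq_bc.
pose U2 := U1 :\ b :\ c.
have sU2 : U2 \subset U1 by rewrite /U2 (subset_trans (subD1set _ _)) ?subD1set.
have sU2U := subset_trans sU2 sU1.
have [||||ts [tsP sz ts_U ts_sub]] := IH U2 ys1 _ uniq_ys1 _ _ sz_ys1.
- by move=> x y /(subsetP sU2U) xU /(subsetP sU2U) yU; apply: U_clique.
- by move=> y /sub_ys /ysU; apply: contra; apply: (subsetP sU2U).
- move=> y /sub_ys /ys_few; apply: leq_trans.
  apply/subset_leq_card/subsetP => u.
  by rewrite in_set => /andP[/(subsetP sU2U) uU yu]; rewrite in_set uU.
- have := cardsD1 b U1; have := cardsD1 c (U1 :\ b).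
  by rewrite !inE bU1 cU1 eq_sym neq_bc /= -/U2; lia.
have [bU cU] : b \in U /\ c \in U by rewrite !(subsetP sU1).
have out x : x \notin U2 -> x \notin ys1 -> x \notin flatten ts.
  by move=> xU x_ys; apply/negP=> /ts_sub/orP[]; apply/negP.
have neq_a x : x \in U1 -> a != x by apply: contraTneq => <-.
have a_ts : a \notin flatten ts.
  by apply: out => //; apply: contra aU1; apply: (subsetP sU2).
have b_ts : b \notin flatten ts.
  by apply: out; [rewrite !inE eqxx andbF | apply: contraL bU => /sub_ys/ysU].
have c_ts : c \notin flatten ts.
  by apply: out; [rewrite !inE eqxx | apply: contraL cU => /sub_ys/ysU].
exists ([:: a; b; c] :: ts); split.
- case/and3P: tsP => ts_uniq ts_3 ts_adj.
  apply/and3P; split=> //=; last by rewrite ab ac U_clique.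
  by rewrite !(inE, negb_or) !neq_a // neq_bc a_ts b_ts c_ts.
- by rewrite /= sz.
- rewrite /= bU orbT /=; apply: sub_all ts_U => t; apply: sub_has => x.
  exact: (subsetP sU2U).
- move=> x; rewrite /= !inE => /or4P[/eqP-> | /eqP-> | /eqP-> | /ts_sub] //.
  + by rewrite bU orbT.
  + by rewrite cU orbT.
  by case/orP=> [/sub_ys-> // | /(subsetP sU2U)->]; rewrite orbT.
Qed.

(** * Upper bound for two-colourings *)

Lemma color_adjE (N : nat) (c : coloring N) (x y : 'I_N) :
  color_adj c Red x y = (x != y) && ~~ color_adj c Blue x y.
Proof. by rewrite /color_adj; case: (c _); case: eqP. Qed.

Lemma arrows_upper (m n : nat) :
  0 < m -> m <= n ->
  arrows (3 * n + m - 1) (connected_triangle_matching n) (copies m 2).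
Proof.
move=> m_gt0 le_mn c; set N := _ - 1 in c *.
have N_gt0 : 0 < N by lia.
pose x0 := Ordinal N_gt0.
have [[ss ssP sz] | [ss []]] := unaugmentable_matching (color_graph c Blue) m.
  by right; apply: (contains_copies (x0 : color_graph c Blue) ssP).
set U := [set x | _] => ssP sz U_stable ss_has.
left; have [ys [sz_ys ys_sub /allP ys_few]] := transversal_has ss_has.
have {}sz_ys : size ys = size ss := sz_ys.
have /and3P[ss_uniq ss_2 _] := ssP.
have sz_fl : size (flatten ss) = 2 * size ss.
  have /all_pred1P ss_shape : all (pred1 2) (shape ss) by rewrite all_map.
  by rewrite size_flatten ss_shape sumn_nseq size_map.
have sz_U : #|U| + 2 * size ss = N.
  rewrite -sz_fl -(card_uniqP ss_uniq) -[RHS]card_ord.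
  by rewrite -(cardC (mem (flatten ss))) addnC cardsE.
have U_clique : @clique (color_graph c Red) U.
  by move=> x y xU yU neq_xy; rewrite /= color_adjE neq_xy; apply: U_stable.
have [|||||ts [tsP sz_ts ts_U _]] :=
    @greedy_triangles (color_graph c Red) n U ys U_clique.
- exact: subseq_uniq ys_sub ss_uniq.
- by move=> y /(mem_subseq ys_sub) y_fl; rewrite inE y_fl.
(* A non-neighbour of y in red is a blue neighbour or y itself, and y is covered by the matching,
   hence outside [U]. *)
- move=> y y_ys; apply: leq_trans (ys_few y y_ys).
  apply/subset_leq_card/subsetP => u; rewrite in_set [in X in _ -> X]in_set /=.
  case/andP=> uU; rewrite uU color_adjE negb_and !negbK => /orP[/eqP eq_yu|//].
  by move: uU; rewrite inE -eq_yu (mem_subseq ys_sub).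
- by rewrite sz_ys; lia.
(* |U| + |ss| = N - |ss|, which is at least 3n because |ss| is at most m - 1. *)
- by rewrite sz_ys -(leq_add2r (size ss)) -addnA addnn -mul2n sz_U; lia.
exact: (contains_connected_triangles (x0 : color_graph c Red) U_clique tsP).
Qed.

(** * Lower bound by an extremal colouring *)

Lemma leq_card_interval (V : finType) (h : V -> nat) (a k : nat) :
  injective h -> (forall v, a <= h v < a + k) -> #|V| <= k.
Proof.
move=> h_inj h_bound; rewrite cardE -(size_map h) -(size_iota a k).
apply: uniq_leq_size; first by rewrite map_inj_uniq ?enum_uniq.
by move=> _ /mapP[v _ ->]; rewrite mem_iota.
Qed.

(* A red clique on the first 3n - 1 vertices, all other edges blue: a blue
   matching uses one of the remaining vertices in each edge. *)
Lemma not_arrows_lower (m n N : nat) :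
  0 < m -> 0 < n -> N < 3 * n + m - 1 ->
  ~ arrows N (connected_triangle_matching n) (copies m 2).
Proof.
move=> m_gt0 n_gt0 N_lt N_arrows.
pose K := 3 * n - 1.
pose c (S : {set 'I_N}) := if S \subset [set i : 'I_N | i < K] then Red else Blue.
have cE x y : c [set x; y] = if (x < K) && (y < K) then Red else Blue.
  by rewrite /c subUset !sub1set !inE.
have [[H [[_ [g [g_inj g_adj]]] [f [f_inj f_adj]]]] | [f [f_inj f_adj]]] :=
  N_arrows c.
- pose h (p : copies n 3) := nat_of_ord (f (g p)).
  suff : #|{: 'I_n * 'I_3}| <= K by rewrite card_prod !card_ord; lia.
  apply: (@leq_card_interval _ h 0) => [|[i j]].
    exact: inj_comp val_inj (inj_comp f_inj g_inj).
  (* Every triangle vertex has a red neighbour, hence lies among the first K = 3n - 1 vertices, too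
     few for n disjoint triangles. *)
  have [l neq_jl] : exists l : 'I_3, j != l.
    exists (if j == ord0 then ord_max else ord0).
    by case: (eqVneq j ord0) => [->|].
  have /g_adj/f_adj : @adj (copies n 3) (i, j) (i, l).
    by rewrite /= /copies_adj eqxx.
  by rewrite /= /color_adj cE; case: ltnP; rewrite ?andbF.
(* [h] selects an end outside the red clique of each blue edge; disjoint edges give distinct ends,
   and only N - K < m are available. *)
pose h (i : 'I_m) : nat :=
  if K <= f (i, ord0) then f (i, ord0) else f (i, ord_max).
suff : #|'I_m| <= N - K by rewrite card_ord; lia.
apply: (@leq_card_interval _ h K) => [i i'|i].
  by rewrite /h; do 2!case: ifP => _; move=> /val_inj/f_inj[].
have /f_adj : @adj (copies m 2) (i, ord0) (i, ord_max).
  by rewrite /= /copies_adj eqxx.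
rewrite /h /= /color_adj cE.
have := ltn_ord (f (i, ord0)); have := ltn_ord (f (i, ord_max)).
by case: (ltnP (f (i, ord0)) K); case: (ltnP (f (i, ord_max)) K);
  rewrite ?andbF //=; lia.
Qed.

Theorem lemma2 (m n : nat) (hm : 1 <= m) (hmn : m <= n) :
  is_ramsey_number (connected_triangle_matching n) (copies m 2) (3 * n + m - 1).
Proof.
split; first by lia.
- exact: arrows_upper.
move=> N _ N_arrows; rewrite leqNgt; apply/negP => N_lt.
by apply: (not_arrows_lower hm _ N_lt N_arrows); lia.
Qed.
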